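(* Let $d\ge 2$ and $1\le r\le d$ be integers, let $\mathcal{A}$ be a finite alphabet, let $E=\mathcal{A}^{\mathbb{N}}$ be the full shift, and let $X_1,\dots,X_{d-r}\subseteq\mathcal{A}^{\mathbb{N}}$ be subshifts. Let $E^r\otimes_{i=1}^{d-r}X_i\subseteq\mathcal{A}^{\mathbb{N}^d}$ and $E^r\times_{i=1}^{d-r}X_i\subseteq \mathcal{A}^{\mathcal{T}_d}$ be the axial products, on $\mathbb{N}^d$ and on the $d$-tree respectively, of the $d$ shifts $E,\dots,E$ ($r$ times), $X_1,\dots,X_{d-r}$. Then 1. $h\left(E^r\otimes_{i=1}^{d-r}X_i\right)=h\left(\otimes_{i=1}^{d-r}X_i\right)$, where $\otimes_{i=1}^{d-r}X_i\subseteq\mathcal{A}^{\mathbb{N}^{d-r}}$; and 2. $\displaystyle h\left(E^r\times_{i=1}^{d-r}X_i\right)=r(d-1)\sum_{j=1}^{\infty}\frac{\log\left|\mathcal{P}(\Delta_{j-1},\times_{i=1}^{d-r}X_i)\right|}{d^{j+1}}$, where $\times_{i=1}^{d-r}X_i\subseteq\mathcal{A}^{\mathcal{T}_{d-r}}$ and $\Delta_{j-1}$ on the right-hand side is taken in the $(d-r)$-tree $\mathcal{T}_{d-r}$.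
   Context: $\mathbb{N}=\{1,2,\dots\}$. For shifts $Y_1,\dots,Y_m\subseteq\mathcal{A}^{\mathbb{N}}$: the axial product $\otimes_{i=1}^mY_i$ on $\mathbb{N}^m$ is the set of $x\in\mathcal{A}^{\mathbb{N}^m}$ such that for all $g\in\mathbb{N}^m$ and $1\le i\le m$ the sequence $(x_{g+ne_i})_{n\ge0}$ belongs to $Y_i$ ($e_1,\dots,e_m$ the standard basis). The $m$-tree $\mathcal{T}_m$ is the free monoid on generators $f_1,\dots,f_m$, with root $\epsilon$ and word length $|\cdot|$; the axial product $\times_{i=1}^mY_i$ on $\mathcal{T}_m$ is the set of $x\in\mathcal{A}^{\mathcal{T}_m}$ such that for all $g\in\mathcal{T}_m$ and $1\le i\le m$ the sequence $(x_{gf_i^n})_{n\ge0}$ belongs to $Y_i$. For a set $Y$ of configurations and a finite set $F$ of sites, $\mathcal{P}(F,Y)=\{(x_g)_{g\in F}:x\in Y\}$. For $Y\subseteq\mathcal{A}^{\mathbb{N}^m}$, $h(Y)=\lim_{n\to\infty}\frac{\log|\mathcal{P}([1,n]^m,Y)|}{n^m}$; for $Y\subseteq\mathcal{A}^{\mathcal{T}_m}$, $h(Y)=\lim_{n\to\infty}\frac{\log|\mathcal{P}(\Delta_n,Y)|}{|\Delta_n|}$, where $\Delta_n=\{g\in\mathcal{T}_m:|g|\le n\}$. Conventions: when $r=d$, $\mathbb{N}^0$ and $\mathcal{T}_0=\{\epsilon\}$ are single points and the empty axial product is the set of all labelings of that point by $\mathcal{A}$ (so $|\mathcal{P}(\Delta_{j-1},\cdot)|=|\mathcal{A}|$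 and the entropy is $\log|\mathcal{A}|$). If an axial product is empty, its entropy is $0$ and $\log 0$ is read as $0$. *)

(* Defs.v *)
From HB Require Import structures.
From mathcomp Require Import all_boot all_order all_algebra.
From mathcomp Require Import finmap.
From mathcomp Require Import all_classical all_reals all_analysis.

Set Implicit Arguments.
Unset Strict Implicit.
Unset Printing Implicit Defensive.

Import Order.TTheory GRing.Theory Num.Theory.
Import numFieldNormedType.Exports.

Local Open Scope classical_set_scope.
Local Open Scope ring_scope.

(* N = {1, 2, ...} is re-indexed as nat = {0, 1, ...} through
   k |-> k - 1; a site (g_1, ..., g_m) of N^m is the vector of the g_i - 1. *)
Notation vsite m := {ffun 'I_m -> nat}.

(* The m-tree: the free monoid on f_i (i : 'I_m), with catenation as product,
   [::] as root and size as word length. *)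
Notation tsite m := (seq 'I_m).

(* Subshift of A^N: closed for the product of the discrete topologies and mapped
   into itself by the one-sided shift. The empty set is allowed. *)
Definition subshift (A : finType) (X : set (nat -> A)) : Prop :=
  closed (X : set (prod_topology (fun _ : nat => discrete_topology A))) /\
  (forall x, X x -> X (fun n => x n.+1)).

(* g + n e_i *)
Definition vmove (m : nat) (g : vsite m) (i : 'I_m) (n : nat) : vsite m :=
  [ffun j => if j == i then (g j + n)%N else g j].

(* g f_i^n *)
Definition tmove (m : nat) (g : tsite m) (i : 'I_m) (n : nat) : tsite m :=
  g ++ nseq n i.

Definition vaxial (A : finType) (m : nat) (Y : 'I_m -> set (nat -> A)) :
    set (vsite m -> A) :=
  [set x | forall (g : vsite m) (i : 'I_m), Y i (fun n => x (vmove g i n))].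

Definition taxial (A : finType) (m : nat) (Y : 'I_m -> set (nat -> A)) :
    set (tsite m -> A) :=
  [set x | forall (g : tsite m) (i : 'I_m), Y i (fun n => x (tmove g i n))].

(* The d shifts E, ..., E (r times), X_1, ..., X_(d-r), E being the full shift. *)
Definition full_prepend (A : finType) (d r : nat) (hrd : (r <= d)%N)
    (X : 'I_(d - r)%N -> set (nat -> A)) (i : 'I_d) : set (nat -> A) :=
  match fintype.split (cast_ord (esym (subnKC hrd)) i) with
  | inl _ => setT
  | inr k => X k
  end.

Definition patterns (G : choiceType) (A : finType) (F : {fset G})
    (Y : set (G -> A)) : {set {ffun F -> A}} :=
  [set p : {ffun F -> A} |
    `[< exists2 x : G -> A, Y x & p = [ffun g => x (val g)] >]]%SET.

(* [1, n]^m, that is {0, ..., n - 1}^m after re-indexing *)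
Definition vbox (m n : nat) : {fset vsite m} :=
  [fset [ffun i => nat_of_ord (f i)] |
    f : {ffun 'I_m -> 'I_n} in {: {ffun 'I_m -> 'I_n}}]%fset.

(* Delta_n *)
Definition tball (m n : nat) : {fset tsite m} :=
  (\bigcup_(k <- iota 0 n.+1) [fset tval t | t in {: k.-tuple 'I_m}])%fset.

Lemma in_vbox (m n : nat) (g : vsite m) :
  (g \in vbox m n) = [forall i, (g i < n)%N].
Proof.
apply/imfsetP/forallP => /= [[f _ ->] i|gn]; first by rewrite ffunE.
by exists [ffun i => Ordinal (gn i)] => //; apply/ffunP => i; rewrite !ffunE.
Qed.

Lemma in_tball (m n : nat) (g : tsite m) : (g \in tball m n) = (size g <= n)%N.
Proof.
apply/bigfcupP/idP => [[k]|gn].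
  by rewrite andbT mem_iota => kn /imfsetP[t _ ->]; rewrite size_tuple.
exists (size g); first by rewrite andbT mem_iota.
by apply/imfsetP; exists (in_tuple g).
Qed.

(* ln 0 = 0 in the library, which is the convention wanted for empty products. *)
Definition vrate (R : realType) (A : finType) (m : nat) (Y : set (vsite m -> A))
    (n : nat) : R :=
  ln #|patterns (vbox m n) Y|%:R / (n ^ m)%N%:R.

Definition trate (R : realType) (A : finType) (m : nat) (Y : set (tsite m -> A))
    (n : nat) : R :=
  ln #|patterns (tball m n) Y|%:R / #|` tball m n|%:R.

(* lim is total in the library: existence of the limits is asserted separately. *)
Definition ventropy (R : realType) (A : finType) (m : nat)
    (Y : set (vsite m -> A)) : R := limn (vrate R Y).

Definition tentropy (R : realType) (A : finType) (m : nat)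
    (Y : set (tsite m -> A)) : R := limn (trate R Y).

(* Main.v *)
(* A configuration of the axial product with r full shifts is a free choice of
   configurations of the axial product X of the remaining m = d - r shifts, one on
   each coset of the sub-lattice (resp. sub-tree) spanned by the last m directions.
   Hence the number of patterns on a box or ball is the product over these cosets of
   the number of X-patterns on their traces. In N^d a box of side n is cut into n^r
   boxes of side n of N^m, which makes the two normalised counts equal. In the tree,
   a ball of radius n is cut into one ball of radius n and, for each k < n,
   r d^k balls of radius n - k - 1 of the m-tree; dividing by the size of the ball
   gives the partial sums of the series up to a factor tending to d - 1. The limit
   for X on N^m exists by subadditivity over cubes. *)
Require Import Defs.
From mathcomp Require Import all_boot all_order all_algebra.
From mathcomp Require Import finmap.
From mathcomp Require Import all_classical all_reals all_analysis.
From mathcomp Require Import ring lra.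

Import Order.TTheory GRing.Theory Num.Theory.
Import numFieldNormedType.Exports.

Local Open Scope classical_set_scope.
Local Open Scope ring_scope.

(** * Counting patterns by cutting a set of sites into pieces *)

Lemma patternsP (G : choiceType) (A : finType) (F : {fset G})
    (Y : set (G -> A)) (p : {ffun F -> A}) :
  reflect (exists2 x, Y x & p = [ffun g => x (val g)]) (p \in patterns F Y).
Proof. by rewrite inE; exact: asboolP. Qed.

Lemma card_patterns_eq0 (G : choiceType) (A : finType) (F : {fset G})
    (Y : set (G -> A)) : #|patterns F Y| = 0%N <-> Y = set0.
Proof.
split=> [/eqP|->].
  rewrite cards_eq0 => /eqP P0; rewrite -subset0 => x Yx.
  have : [ffun g : F => x (val g)] \in patterns F Y by apply/patternsP; exists x.
  by rewrite P0 finset.in_set0.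
by apply/eqP; rewrite cards_eq0 -finset.subset0; apply/fintype.subsetP => p /patternsP[].
Qed.

Lemma card_patterns_leq (G : choiceType) (A : finType) (F : {fset G})
    (Y : set (G -> A)) : (#|patterns F Y| <= #|A| ^ #|` F|)%N.
Proof. by rewrite (leq_trans (max_card _))// card_ffun -cardfE. Qed.

Section PatternProduct.
Context {G S : choiceType} {A : finType} {I : finType}.
Variables (F : {fset G}) (D : I -> {fset S}) (phi : I -> S -> G).
Variables (Y' : set (G -> A)) (Y : set (S -> A)).
Hypothesis restr : forall x i, Y' x -> Y (x \o phi i).
Hypothesis cover :
  forall g, g \in F -> exists i, exists2 s, s \in D i & phi i s = g.

(** The pieces may overlap: each site of [F] is assigned to one piece containing it, and gluing
    along this choice recovers every pattern on [F] from its restrictions to the pieces. *)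
Lemma card_patterns_leq_prod :
  (#|patterns F Y'| <= \prod_i #|patterns (D i) Y|)%N.
Proof.
have /choice[t tE] : forall g : F, exists u : {i : I & D i},
    phi (tag u) (val (tagged u)) = val g.
  move=> [g gF]; have [i [s sD sE]] := cover _ gF.
  by exists (Tagged (fun i => D i) [` sD]%fset).
rewrite -cardsXn.
pose glue (q : {dffun forall i : I, {ffun D i -> A}}) : {ffun F -> A} :=
  [ffun g => q (tag (t g)) (tagged (t g))].
apply: leq_trans (leq_imset_card glue _); apply/subset_leq_card/fintype.subsetP.
move=> _ /patternsP[x Yx ->]; apply/imsetP.
exists [ffun i => [ffun s : D i => x (phi i (val s))]].
  rewrite in_setXn; apply/forallP => i; apply/patternsP.
  by exists (x \o phi i); [exact: restr|rewrite ffunE].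
by apply/ffunP => g; rewrite !ffunE tE.
Qed.

Hypothesis inj : forall i s, s \in D i -> phi i s \in F.
Hypothesis extend : forall y : I -> S -> A, (forall i, Y (y i)) ->
  exists2 x, Y' x & forall i s, s \in D i -> x (phi i s) = y i s.

(** For the reverse inequality, [cut] reaches every family of patterns, because [extend] realises
    arbitrary choices on the pieces simultaneously; this takes the place of disjointness. *)
Lemma card_patterns_prod :
  #|patterns F Y'| = (\prod_i #|patterns (D i) Y|)%N.
Proof.
apply/eqP; rewrite eqn_leq card_patterns_leq_prod/= -cardsXn.
pose cut (p : {ffun F -> A}) : {dffun forall i : I, {ffun D i -> A}} :=
  [ffun i => [ffun s : D i => p [` inj _ _ (valP s)]%fset]].
apply: leq_trans (leq_imset_card cut _); apply/subset_leq_card/fintype.subsetP.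
move=> q; rewrite in_setXn => /forallP qP.
have /choice[y yP] : forall i, exists y, Y y /\ q i = [ffun s => y (val s)].
  by move=> i; have /patternsP[y Yy yE] := qP i; exists y.
have [x Yx xE] := extend y (fun i => (yP i).1).
apply/imsetP; exists [ffun g => x (val g)]; first by apply/patternsP; exists x.
apply/ffunP => i; rewrite ffunE (yP i).2; apply/ffunP => s.
by rewrite !ffunE/= xE ?valP.
Qed.
End PatternProduct.

(** * Full directions on the lattice *)

Definition prepend_full {A : finType} {r m : nat} (X : 'I_m -> set (nat -> A))
    (i : 'I_(r + m)) : set (nat -> A) :=
  match fintype.split i with inl _ => setT | inr k => X k end.

Lemma prepend_full_lshift (A : finType) (r m : nat) (X : 'I_m -> set (nat -> A))
  (i : 'I_r) : prepend_full X (lshift m i) = setT.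
Proof. by rewrite /prepend_full (unsplitK (inl i)). Qed.

Lemma prepend_full_rshift (A : finType) (r m : nat) (X : 'I_m -> set (nat -> A))
  (i : 'I_m) : prepend_full X (rshift r i) = X i.
Proof. by rewrite /prepend_full (unsplitK (inr i)). Qed.

(** The cube of side [n] is covered by [q ^ m] translates of the cube of side [k], and the axial
    product is invariant under translation. *)
Lemma card_vpatterns_cover (A : finType) (m n k q : nat)
    (X : 'I_m -> set (nat -> A)) : (0 < k)%N -> (n <= q * k)%N ->
  (#|patterns (vbox m n) (vaxial X)| <=
    #|patterns (vbox m k) (vaxial X)| ^ (q ^ m))%N.
Proof.
move=> k0 nqk.
pose phi (u : {ffun 'I_m -> 'I_q}) (s : vsite m) : vsite m :=
  [ffun j => u j * k + s j]%N.
rewrite (leq_trans (card_patterns_leq_prod _ (fun=> vbox m k) phi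
  (vaxial X) (vaxial X) _ _))//.
- move=> x u Xx g i; have := Xx (phi u g) i; congr (X i _).
  apply/funext => l /=; congr x; apply/ffunP => j; rewrite !ffunE.
  by case: ifP => //; rewrite addnA.
- move=> g; rewrite in_vbox => /forallP gn.
  have gk j : (g j %/ k < q)%N by rewrite ltn_divLR// (leq_trans (gn j)).
  exists [ffun j => Ordinal (gk j)]; exists [ffun j => g j %% k]%N.
    by rewrite in_vbox; apply/forallP => j; rewrite ffunE ltn_pmod.
  by apply/ffunP => j; rewrite !ffunE /= -divn_eq.
- by rewrite prod_nat_const card_ffun !card_ord.
Qed.

Lemma card_vpatterns_prepend (A : finType) (r m n : nat)
    (X : 'I_m -> set (nat -> A)) :
  #|patterns (vbox (r + m) n.+1) (vaxial (prepend_full X))| =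
  (#|patterns (vbox m n.+1) (vaxial X)| ^ (n.+1 ^ r))%N.
Proof.
pose phi (u : {ffun 'I_r -> 'I_n.+1}) (s : vsite m) : vsite (r + m) :=
  [ffun j => match fintype.split j with inl a => u a : nat | inr b => s b end].
have phil u s a : phi u s (lshift m a) = u a.
  by rewrite ffunE (unsplitK (inl a)).
have phir u s b : phi u s (rshift r b) = s b.
  by rewrite ffunE (unsplitK (inr b)).
have eq_site (g h : vsite (r + m)) : (forall a, g (lshift m a) = h (lshift m a)) ->
    (forall b, g (rshift r b) = h (rshift r b)) -> g = h.
  move=> gl gr; apply/ffunP => j.
  by rewrite -(splitK j); case: (fintype.split j) => c /=.
rewrite (card_patterns_prod _ (fun=> vbox m n.+1) phi (vaxial _) (vaxial X)).
- by rewrite prod_nat_const card_ffun !card_ord.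
- move=> x u Xx g i; have := Xx (phi u g) (rshift r i).
  rewrite prepend_full_rshift; congr (X i _).
  apply/funext => l /=; congr x; apply: eq_site => c.
    by rewrite !phil ffunE phil eq_lrshift.
  rewrite !phir [LHS]ffunE phir.
  by rewrite [RHS]ffunE (inj_eq (@rshift_inj _ _)).
- move=> g; rewrite in_vbox => /forallP gn.
  exists [ffun a => Ordinal (gn (lshift m a))]; exists [ffun b => g (rshift r b)].
    by rewrite in_vbox; apply/forallP => j; rewrite ffunE.
  by apply: eq_site => c; rewrite ?phil ?phir ffunE.
- move=> u s; rewrite !in_vbox => /forallP sn; apply/forallP => j.
  by rewrite ffunE; case: fintype.split.
- move=> y Yy.
  (* Slices outside the box get the index 0 wherever [inord] is out of range. This is harmless: a
     move in a constrained direction leaves [u g] unchanged. *)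
  pose u (g : vsite (r + m)) : {ffun 'I_r -> 'I_n.+1} :=
    [ffun a => inord (g (lshift m a))].
  exists (fun g => y (u g) [ffun b => g (rshift r b)]) => [g i|v s _].
    rewrite -(splitK i); case: (fintype.split i) => c /=.
      by rewrite prepend_full_lshift.
    rewrite prepend_full_rshift; have := Yy (u g) [ffun b => g (rshift r b)] c.
    congr (X c _); apply/funext => l; congr y.
      by apply/ffunP => a; rewrite !ffunE eq_lrshift.
    by apply/ffunP => b; rewrite !ffunE (inj_eq (@rshift_inj _ _)).
  congr y; apply/ffunP => c; rewrite ffunE ?phil ?phir//.
  by rewrite inord_val.
Qed.

(** * Balls and cosets in the tree *)

Lemma card_tball (m n : nat) : #|` tball m n| = (\sum_(k < n.+1) m ^ k)%N.
Proof.
pose T := {k : 'I_n.+1 & k.-tuple 'I_m}.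
have -> : tball m n = [fset tval (tagged u) | u in {: T}]%fset.
  apply/fsetP => g; rewrite in_tball; apply/idP/imfsetP => /= [gn|[u _ ->]].
    by exists (Tagged (fun k : 'I_n.+1 => k.-tuple 'I_m)
      (in_tuple g : (Ordinal (gn : size g < n.+1)%N).-tuple 'I_m)).
  by rewrite size_tuple -ltnS.
rewrite card_imfset /=; last first.
  move=> [k1 t1] [k2 t2] /= t12.
  have k12 : k1 = k2 by apply/val_inj; rewrite /= -(size_tuple t1) t12 size_tuple.
  by move: t1 t12; rewrite k12 => t1 /val_inj ->.
rewrite -cardE card_tagged sumnE big_map big_enum.
by apply: eq_bigr => k _; rewrite card_tuple card_ord.
Qed.

Section TreeDecomposition.
Variables r m : nat.

(* Every site of the tree on r + m letters is uniquely k f with f a word in the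
   last m letters and k either empty (None) or ending with one of the first r
   letters; Some (h, e) encodes h f_e. *)
Definition stem (k : option (tsite (r + m) * 'I_r)) : tsite (r + m) :=
  if k is Some (h, e) then rcons h (lshift m e) else [::].

Definition branch k (s : tsite m) : tsite (r + m) := stem k ++ map (@rshift r m) s.

(** One step of a scan from the root: a letter of a full direction closes a new stem and empties the
    suffix, any other letter extends the suffix. *)
Definition unbranch_step (u : option (tsite (r + m) * 'I_r) * tsite m)
    (i : 'I_(r + m)) :=
  match fintype.split i with
  | inl e => (Some (branch u.1 u.2, e), [::])
  | inr b => (u.1, rcons u.2 b)
  end.

Definition unbranch (g : tsite (r + m)) := foldl unbranch_step (None, [::]) g.

Lemma unbranchK g : branch (unbranch g).1 (unbranch g).2 = g.
Proof.
elim/last_ind: g => // g i IH; rewrite /unbranch foldl_rcons -/(unbranch g).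
rewrite -[in RHS](splitK i) /unbranch_step.
case: (fintype.split i) => c; rewrite /branch/=.
  by rewrite cats0 -/(branch _ _) IH.
by rewrite map_rcons -rcons_cat -/(branch _ _) IH.
Qed.

(** Moves along the last [m] letters stay in one coset, so the constraints never link two different
    stems. *)
Lemma unbranch_cat g (s : tsite m) :
  unbranch (g ++ map (@rshift r m) s) = ((unbranch g).1, (unbranch g).2 ++ s).
Proof.
elim/last_ind: s => [|s b IH]; first by rewrite !cats0 -surjective_pairing.
rewrite map_rcons -rcons_cat /unbranch foldl_rcons -/(unbranch _) IH.
by rewrite /unbranch_step (unsplitK (inr b)) rcons_cat.
Qed.

Lemma branchK k s : unbranch (branch k s) = (k, s).
Proof.
rewrite /branch unbranch_cat; case: k => [[h e]|]//=.
rewrite /unbranch foldl_rcons -/(unbranch h) /unbranch_step (unsplitK (inl e)).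
by rewrite unbranchK.
Qed.

End TreeDecomposition.
Arguments unbranch {r m}.

Lemma card_tpatterns_prepend (A : finType) (r m n : nat)
    (X : 'I_m -> set (nat -> A)) :
  #|patterns (tball (r + m) n) (taxial (prepend_full X))| =
  (#|patterns (tball m n) (taxial X)| *
   \prod_(k < n) #|patterns (tball m (n - k.+1)) (taxial X)| ^ ((r + m) ^ k * r))%N.
Proof.
(* Finite index type for the stems of length at most [n]. A coset whose stem has length [l] meets
   the ball in a ball of radius [n - l] of the [m]-tree. *)
pose T := (unit + {k : 'I_n & (k.-tuple 'I_(r + m) * 'I_r)%type})%type.
pose code (i : T) : option (tsite (r + m) * 'I_r) :=
  if i is inr u then Some (tval (tagged u).1, (tagged u).2) else None.
have code_inj : injective code.
  move=> [[]|[k1 [t1 e1]]] [[]|[k2 [t2 e2]]] //= [t12 e12].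
  have k12 : k1 = k2 by apply/val_inj; rewrite /= -(size_tuple t1) t12 size_tuple.
  by move: t1 t12; rewrite k12 e12 => t1 /val_inj ->.
pose depth (i : T) : nat := if i is inr u then (tag u).+1 else 0%N.
have size_code i : size (stem _ _ (code i)) = depth i.
  by case: i => [|[k [t e]]]//=; rewrite size_rcons size_tuple.
have codeP k : (size (stem _ _ k) <= n)%N -> exists i, code i = k.
  case: k => [[h e]|_]; last by exists (inl tt).
  rewrite /= size_rcons => hn.
  by exists (inr (Tagged (fun k : 'I_n => (k.-tuple 'I_(r + m) * 'I_r)%type)
      (in_tuple h : (Ordinal hn).-tuple 'I_(r + m), e))).
rewrite (card_patterns_prod _ (fun i => tball m (n - depth i))
  (fun i => branch r m (code i)) (taxial _) (taxial X)).
- rewrite big_sumType/= prod_nat_const card_unit expn1 subn0.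
  congr (_ * _)%N.
  rewrite -(sig_big_dep xpredT (fun=> xpredT)
    (fun (k : 'I_n) =>fun=> #|patterns (tball m (n - k.+1)) (taxial X)|))/=.
  apply: eq_bigr => k _.
  by rewrite prod_nat_const card_prod card_tuple !card_ord.
- move=> x i Xx g b; have := Xx (branch _ _ (code i) g) (rshift r b).
  rewrite prepend_full_rshift; congr (X b _); apply/funext => l /=; congr x.
  by rewrite /tmove /branch map_cat map_nseq catA.
- move=> g; rewrite in_tball => gn.
  have gE := unbranchK _ _ g; move: gn; rewrite -{1}gE size_cat size_map => gn.
  have [i iE] := codeP _ (leq_trans (leq_addr _ _) gn).
  exists i, (unbranch g).2; last by rewrite iE.
  by rewrite in_tball -size_code iE leq_subRL// (leq_trans (leq_addr _ _) gn).
- move=> i s; rewrite !in_tball size_cat size_map size_code => sn.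
  have /= : (depth i <= n)%N by case: (i) => //= u.
  by move=> dn; rewrite -leq_subRL.
- move=> y Yy.
  (* Stems longer than [n] have no code and receive an arbitrary allowed configuration; their cosets
     miss the ball. *)
  pose y' k := if [pick i | code i == k] is Some i then y i else y (inl tt).
  have Yy' k : taxial X (y' k) by rewrite /y'; case: pickP.
  exists (fun g => y' (unbranch g).1 (unbranch g).2) => [g i|i s _].
    rewrite -(splitK i); case: (fintype.split i) => c /=.
      by rewrite prepend_full_lshift.
    rewrite prepend_full_rshift; have := Yy' (unbranch g).1 (unbranch g).2 c.
    congr (X c _); apply/funext => l.
    by rewrite /tmove -map_nseq unbranch_cat.
  rewrite branchK /= /y'; case: pickP => [j /eqP /code_inj -> //|/(_ i)].
  by rewrite eqxx.
Qed.

(** * Logarithms, subadditivity and the tree series *)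

Lemma ln_nat_ge0 (R : realType) (a : nat) : 0 <= ln (a%:R : R).
Proof. by case: a => [|a]; [rewrite ln0|rewrite ln_ge0// ler1n]. Qed.

Lemma ler_ln_nat (R : realType) (a b : nat) :
  (a <= b)%N -> ln (a%:R : R) <= ln (b%:R : R).
Proof.
case: a => [_|a ab]; first by rewrite ln0// ln_nat_ge0.
by rewrite ler_ln ?posrE ?ltr0n ?(leq_trans _ ab)// ler_nat.
Qed.

(** The base 0 is included through [ln 0 = 0], so empty axial products need no separate case on the
    lattice. *)
Lemma ln_natX (R : realType) (a n : nat) :
  (0 < n)%N -> ln ((a ^ n)%:R : R) = n%:R * ln a%:R.
Proof.
case: a => [|a] n0; first by rewrite exp0n// ln0// mulr0.
by rewrite natrX lnXn ?ltr0n// mulr_natl.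
Qed.

(** Fekete's argument: the limit is the infimum of the [u k]. For [k] nearly optimal, [u n] is at
    most [(1/k + 1/n)^m * a k], which tends to [u k]. *)
Lemma cvgn_cube_subadditive (R : realType) (m : nat) (a : nat -> R) :
  (forall n, 0 <= a n) ->
  (forall n k, (0 < k)%N -> a n <= ((n %/ k).+1 ^ m)%:R * a k) ->
  cvgn (fun n => a n / (n ^ m)%N%:R).
Proof.
move=> a0 suba; set u := fun n => _.
have u0 n : 0 <= u n by rewrite divr_ge0.
(* Index 0 is excluded: for positive [m], division by zero makes [u 0] equal to 0, which could
   falsify the infimum. *)
pose E := [set u k | k in [set k | (0 < k)%N]].
have infE : has_inf E.
  by split; [exists (u 1%N), 1%N|exists 0 => _ [k _ <-]].
apply/cvg_ex; exists (inf E); apply/cvgrPdist_le => /= e e0.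
have [_ [k k0 <-] ukE] := inf_adherent e0 infE.
have cvgv : ((k%:R^-1 + n%:R^-1) ^+ m * a k : R) @[n --> \oo] --> u k.
  have -> : u k = (k%:R^-1 + 0) ^+ m * a k by rewrite addr0 exprVn -natrX mulrC.
  apply: cvgM; last exact: cvg_cst.
  apply: (@continuous_cvg _ _ _ _ _ _ (fun x : R => x ^+ m)).
    exact: exprn_continuous.
  apply: cvgD; first exact: cvg_cst.
  by rewrite -(cvg_shiftS (fun n => n%:R^-1 : R)); exact: cvg_harmonic.
have /= vE := cvgr_lt _ cvgv _ ukE.
near=> n.
have n0 : (0 < n)%N by near: n; exact: nbhs_infty_gt.
have uE : inf E <= u n by apply: ge_inf; [exact: infE.2|exists n].
rewrite distrC ger0_norm ?subr_ge0// lerBlDl.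
apply: (@le_trans _ _ ((k%:R^-1 + n%:R^-1) ^+ m * a k)); last first.
  by apply: ltW; near: n; exact: vE.
rewrite /u ler_pdivrMr ?ltr0n ?expn_gt0 ?n0// mulrAC natrX -exprMn.
apply: le_trans (suba n k k0) _; rewrite ler_wpM2r// natrX lerXn2r ?nnegrE//.
rewrite mulrDl mulVf ?pnatr_eq0 -?lt0n// mulrC -natr1 lerD2r ler_pdivlMr ?ltr0n//.
by rewrite -natrM ler_nat leq_trunc_div.
Unshelve. all: by end_near. Qed.

Lemma sum_geometric_nat (R : realType) (d n : nat) : (0 < d)%N ->
  (d%:R - 1) * (\sum_(k < n.+1) d ^ k)%N%:R = (d ^ n.+1)%:R - 1 :> R.
Proof.
move=> d0; rewrite natrX subrX1 natr_sum; congr (_ * _).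
by apply: eq_bigr => k _; rewrite natrX.
Qed.

(* The summand is dominated by the decrement of (d s_N + 2) / d^N, where s_N is the
   number of sites of the m-tree of length at most N, because s_(N+1) = 1 + m s_N. *)
Lemma sum_tball_ratio_le (R : realType) (m d N : nat) : (2 <= d)%N -> (m < d)%N ->
  \sum_(i < N) (\sum_(k < i.+1) m ^ k)%N%:R / (d ^ i)%:R <= d%:R + 2 :> R.
Proof.
move=> d2 md; pose s i : R := (\sum_(k < i.+1) m ^ k)%N%:R.
have s0 i : 0 <= s i by [].
have sS i : s i.+1 = 1 + m%:R * s i.
  rewrite /s big_ord_recl expn0 natrD; congr (_ + _); rewrite -natrM; congr _%:R.
  by rewrite big_distrr; apply: eq_bigr => k _; rewrite /= -expnS.
have dR2 : 2 <= d%:R :> R by rewrite (ler_nat _ 2).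
have mdR : m%:R + 1 <= d%:R :> R by rewrite natr1 ler_nat.
(* Keeping the telescoping remainder on the left makes the induction work; at [N = 0] equality
   holds. *)
suff: \sum_(i < N) s i / (d ^ i)%:R + (d%:R * s N + 2) / (d ^ N)%:R <= d%:R + 2.
  by apply: le_trans; rewrite lerDl divr_ge0// addr_ge0// mulr_ge0.
elim: N => [|N IH].
  by rewrite big_ord0 add0r expn0 divr1 /s big_ord1 expn0 mulr1.
apply: le_trans IH; rewrite big_ord_recr/= -addrA lerD2l sS expnSr natrM.
have dN0 : 0 < (d ^ N)%:R :> R by rewrite ltr0n expn_gt0 (leq_trans _ d2).
have d0 : 0 < d%:R :> R by lra.
rewrite -subr_ge0 (_ : _ - _ =
  (d%:R * s N * (d%:R - (m%:R + 1)) + (d%:R - 2)) / ((d ^ N)%:R * d%:R)).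
  by rewrite divr_ge0 ?mulr_ge0// addr_ge0 ?mulr_ge0 ?subr_ge0.
by field; rewrite !gt_eqF.
Qed.

Section TreeRate.
Context {R : realType} (m d r : nat) (b : nat -> R) (c : R).
Hypotheses (d2 : (2 <= d)%N) (md : (m < d)%N).
Hypotheses (b0 : forall n, 0 <= b n).
Hypothesis b_le : forall n, b n <= c * (\sum_(k < n.+1) m ^ k)%N%:R.

(** The summand of the series at [j = n + 1]; [b n] stands for the logarithm of the number of
    patterns on the ball of radius [n]. *)
Let t n := b n / (d ^ n.+2)%:R.

Lemma cvgn_tree_series : cvgn (series t).
Proof.
have t0 n : 0 <= t n by rewrite divr_ge0.
have c0 : 0 <= c.
  by have := le_trans (b0 0) (b_le 0); rewrite big_ord1 expn0 mulr1.
apply: nondecreasing_is_cvgn.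
  by apply/nondecreasing_seqP => n; rewrite seriesSr lerDl.
exists (c * (d%:R + 2)) => _ [n _ <-]; rewrite /series/= big_mkord.
apply: le_trans (ler_wpM2l c0 (sum_tball_ratio_le R m d n d2 md)).
rewrite mulr_sumr ler_sum// => i _; rewrite mulrA /t ler_pM ?invr_ge0//.
rewrite lef_pV2 ?posrE ?ltr0n ?expn_gt0 ?(leq_trans _ d2)// ler_nat.
by rewrite leq_exp2l// -addn2 leq_addr.
Qed.

Lemma cvgn_tree_rate :
  (b n + \sum_(k < n) (d ^ k * r)%:R * b (n - k.+1)%N) / (\sum_(k < n.+1) d ^ k)%N%:R
    @[n --> \oo] --> r%:R * (d%:R - 1) * limn (series t).
Proof.
have d0 : 0 < d%:R :> R by rewrite ltr0n (leq_trans _ d2).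
have d1 : 1 < d%:R :> R by rewrite ltr1n.
have dn0 n : 0 < (d ^ n)%:R :> R by rewrite ltr0n expn_gt0 (leq_trans _ d2).
(* An exact identity for every [n], obtained by reversing the sum and evaluating the geometric
   denominator. The ball at the root contributes only [d * t n], which vanishes in the limit as a
   term of a convergent series. *)
rewrite (_ : (fun n => _) = (fun n =>
  (d%:R - 1) / (1 - d%:R^-1 ^+ n.+1) * (d%:R * t n + r%:R * series t n))).
  rewrite mulrAC -mulrA [X in _ --> X](_ : _ =
    ((d%:R - 1) / (1 - 0)) * (d%:R * 0 + r%:R * limn (series t))); last first.
    by rewrite subr0 divr1 mulr0 add0r; ring.
  apply: cvgM.
    apply: cvgM; first exact: cvg_cst.
    apply: cvgV; first by rewrite subr0 oner_eq0.
    apply: cvgB; first exact: cvg_cst.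
    rewrite (cvg_shiftS (fun n => d%:R^-1 ^+ n : R)); apply: cvg_expr.
    by rewrite ger0_norm ?invr_ge0 ?(ltW d0)// invf_lt1.
  apply: cvgD; apply: cvgM; try exact: cvg_cst.
    exact: cvg_series_cvg_0 cvgn_tree_series.
  exact: cvgn_tree_series.
apply/funext => n.
have -> : \sum_(k < n) (d ^ k * r)%:R * b (n - k.+1)%N =
    (d ^ n.+1)%:R * r%:R * series t n.
  rewrite /series/= big_mkord mulr_sumr (reindex_inj rev_ord_inj)/=.
  apply: eq_bigr => i _; rewrite subnSK// subKn 1?ltnW// /t.
  have -> : (n.+1 = (n - i.+1) + i.+2)%N by rewrite addnS subnK.
  rewrite expnD; have := dn0 i.+2; move: (d ^ i.+2)%N => P P0.
  by rewrite !natrM; field; rewrite gt_eqF.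
have -> : b n = (d ^ n.+1)%:R * (d%:R * t n).
  rewrite /t [in RHS](expnS _ n.+1) natrM; have := dn0 n.+1.
  by move: (d ^ n.+1)%N => P P0; field; rewrite !gt_eqF.
have D0 : 0 < (\sum_(k < n.+1) d ^ k)%N%:R :> R.
  by rewrite ltr0n big_ord_recl expn0.
have -> : d%:R^-1 ^+ n.+1 = (d ^ n.+1)%:R^-1 :> R by rewrite natrX exprVn.
have e0 : (d ^ n.+1)%:R - 1 != 0 :> R.
  by rewrite subr_eq0 gt_eqF// natrX exprn_egt1.
have -> : (\sum_(k < n.+1) d ^ k)%N%:R = ((d ^ n.+1)%:R - 1) / (d%:R - 1) :> R.
  by rewrite -(sum_geometric_nat R d n (leq_trans (ltn0Sn 1) d2))
    [RHS]mulrC mulKf // subr_eq0 gt_eqF.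
move: e0; have := dn0 n.+1; move: (d ^ n.+1)%N => P P0 e0.
by field; rewrite e0 !gt_eqF ?subr_gt0.
Qed.

End TreeRate.

(** * Convergence of the rates and the two entropy formulas *)

Lemma ln_prod (R : realType) (I : finType) (F : I -> R) :
  (forall i, 0 < F i) -> ln (\prod_i F i) = \sum_i ln (F i).
Proof.
(* Positivity of the partial products is carried along, as [lnM] requires it. *)
move=> F0; pose P (x y : R) := 0 < x /\ ln x = y.
suff: P (\prod_i F i) (\sum_i ln (F i)) by case.
elim/big_rec2: _ => [|i y x _ [x0 <-]]; first by split; rewrite ?ln1.
by split; [exact: mulr_gt0|rewrite lnM ?posrE].
Qed.

Lemma cvgn_vrate (R : realType) (A : finType) (m : nat)
    (X : 'I_m -> set (nat -> A)) : cvgn (vrate R (vaxial X)).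
Proof.
apply: cvgn_cube_subadditive => [n|n k k0]; first exact: ln_nat_ge0.
rewrite -ln_natX ?expn_gt0//; apply: ler_ln_nat.
by apply: card_vpatterns_cover => //; rewrite ltnW// ltn_ceil.
Qed.

Lemma vrate_prepend (R : realType) (A : finType) (r m n : nat)
    (X : 'I_m -> set (nat -> A)) :
  vrate R (vaxial (@prepend_full A r m X)) n.+1 = vrate R (vaxial X) n.+1.
Proof.
rewrite /vrate card_vpatterns_prepend ln_natX ?expn_gt0// expnD natrM.
by rewrite mulrC invfM mulrACA mulVf ?mul1r ?pnatr_eq0 -?lt0n ?expn_gt0// mulrC.
Qed.

Lemma ln_card_tpatterns_prepend (R : realType) (A : finType) (r m n : nat)
    (X : 'I_m -> set (nat -> A)) :
  ln #|patterns (tball (r + m) n) (taxial (prepend_full X))|%:R =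
  ln #|patterns (tball m n) (taxial X)|%:R +
  \sum_(k < n) ((r + m) ^ k * r)%:R *
    ln #|patterns (tball m (n - k.+1)) (taxial X)|%:R :> R.
Proof.
rewrite card_tpatterns_prepend.
(* The logarithm splits over positive factors; in the empty case all counts vanish and both sides
   are 0. *)
have [X0|Xn0] := pselect (taxial X = set0).
  have P0 l : #|patterns (tball m l) (taxial X)| = 0%N by apply/card_patterns_eq0.
  rewrite P0 mul0n ln0// big1 ?addr0// => k _.
  by rewrite P0 ln0// mulr0.
have P0 l : (0 < #|patterns (tball m l) (taxial X)|)%N.
  by rewrite lt0n; apply/eqP => /card_patterns_eq0.
have PX0 l e : (0 < #|patterns (tball m l) (taxial X)| ^ e)%N by rewrite expn_gt0 P0.
rewrite natrM lnM ?posrE ?ltr0n ?prodn_gt0//; congr (_ + _).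
rewrite natr_prod ln_prod => [|k]; last by rewrite ltr0n.
by apply: eq_bigr => k _; rewrite natrX lnXn ?ltr0n// mulr_natl.
Qed.

Lemma cvgn_trate_prepend (R : realType) (A : finType) (r m : nat)
    (X : 'I_m -> set (nat -> A)) (t := fun n =>
      ln #|patterns (tball m n) (taxial X)|%:R / ((r + m) ^ n.+2)%:R : R) :
  (2 <= r + m)%N -> (1 <= r)%N ->
  cvgn (series t) /\
  trate R (taxial (@prepend_full A r m X)) @ \oo -->
    r%:R * ((r + m)%:R - 1) * limn (series t).
Proof.
(* At least one full direction gives [m < d], the growth gap behind the convergence of the
   series. *)
move=> d2 r1; have md : (m < r + m)%N by rewrite -[ltnLHS]add0n ltn_add2r.
have b0 n := ln_nat_ge0 R #|patterns (tball m n) (taxial X)|.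
have b_le n : ln #|patterns (tball m n) (taxial X)|%:R <=
    ln #|A|%:R * (\sum_(k < n.+1) m ^ k)%N%:R :> R.
  rewrite -card_tball mulrC -ln_natX; last first.
    by rewrite card_tball big_ord_recl.
  exact/ler_ln_nat/card_patterns_leq.
split; first exact: cvgn_tree_series d2 md b0 b_le.
have := cvgn_tree_rate _ _ r _ _ d2 md b0 b_le.
by under eq_fun do rewrite -card_tball -ln_card_tpatterns_prepend.
Qed.

(** Removes the cast in [full_prepend]: with [m] a variable instead of [d - r], the equation [e] can
    be eliminated, and [P] gathers all that depends on [d]. *)
Lemma full_prepend_transfer (A : finType) (d r m : nat) (e : (r + m)%N = d)
    (X : 'I_m -> set (nat -> A)) (P : forall d, ('I_d -> set (nat -> A)) -> Prop) :
  P (r + m)%N (prepend_full X) ->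
  P d (fun i => match fintype.split (cast_ord (esym e) i) with
                | inl _ => setT | inr k => X k end).
Proof.
case: d / e => H; rewrite (_ : (fun i => _) = prepend_full X)//.
by apply/funext => i; rewrite cast_ord_id.
Qed.

Theorem theorem3p1 (R : realType) (A : finType) (d r : nat)
    (hd : (2 <= d)%N) (hr : (1 <= r)%N) (hrd : (r <= d)%N)
    (X : 'I_(d - r)%N -> set (nat -> A))
    (hX : forall i : 'I_(d - r)%N, subshift (X i)) :
  [/\ cvgn (vrate R (vaxial (full_prepend hrd X))),
      cvgn (vrate R (vaxial X)) &
      ventropy R (vaxial (full_prepend hrd X)) = ventropy R (vaxial X)]
  /\
  [/\ cvgn (trate R (taxial (full_prepend hrd X))),
      cvgn (fun n : nat => \sum_(1 <= j < n)
         ln #|patterns (tball (d - r)%N j.-1) (taxial X)|%:R / (d ^ j.+1)%N%:R : R) &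
      tentropy R (taxial (full_prepend hrd X)) =
        r%:R * (d%:R - 1) *
        \big[+%R/0]_(1 <= j <oo)
          (ln #|patterns (tball (d - r)%N j.-1) (taxial X)|%:R / (d ^ j.+1)%N%:R)].
Proof.
have cvX := cvgn_vrate R A _ X.
pose t n : R := ln #|patterns (tball (d - r) n) (taxial X)|%:R / (d ^ n.+2)%:R.
have [vE [cvt tE]] :
    (forall n, vrate R (vaxial (full_prepend hrd X)) n.+1 = vrate R (vaxial X) n.+1) /\
    (cvgn (series t) /\ trate R (taxial (full_prepend hrd X)) @ \oo -->
       r%:R * (d%:R - 1) * limn (series t)).
  (* [t] is restated inside the predicate so that the [d] in its denominators is transported too. *)
  apply: (full_prepend_transfer _ _ _ _ (subnKC hrd) X (fun d Y => (2 <= d)%N ->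
    (forall n, vrate R (vaxial Y) n.+1 = vrate R (vaxial X) n.+1) /\
    let t n : R := ln #|patterns (tball _ n) (taxial X)|%:R / (d ^ n.+2)%:R in
    cvgn (series t) /\
    trate R (taxial Y) @ \oo --> r%:R * (d%:R - 1) * limn (series t))) => // d2.
  by split=> [n|]; [exact: vrate_prepend|exact: cvgn_trate_prepend].
have cvE : vrate R (vaxial (full_prepend hrd X)) @ \oo --> limn (vrate R (vaxial X)).
  (* The rates are known to agree only for positive sides, hence the shift by one. *)
  rewrite -cvg_shiftS (_ : [sequence _]_n = [sequence vrate R (vaxial X) n.+1]_n).
    by rewrite cvg_shiftS.
  exact/funext.
have sE : (fun n => \sum_(1 <= j < n) ln #|patterns (tball (d - r)%N j.-1)
    (taxial X)|%:R / (d ^ j.+1)%N%:R : R) @ \oo --> limn (series t).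
  rewrite -cvg_shiftS; under eq_fun do rewrite big_add1.
  exact: cvt.
split; split=> //.
- exact: cvgP cvE.
- exact: cvg_lim cvE.
- exact: cvgP tE.
- exact: cvgP sE.
- rewrite /tentropy (cvg_lim _ tE)//; congr (_ * _).
  by apply/esym/cvg_lim.
Qed.
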